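(* Let $\mu$ be a limit cardinal and $\lambda=\mu^+$. (1) Let $S\subseteq\lambda$ be stationary and assume $\clubsuit^\ast_{-\mu}(S)$ holds. Then no normal filter ${\cal D}$ on $\lambda$ with $S\in{\cal D}$ (i.e. no normal filter on $S$) is $\lambda^+$-saturated. (2) Let $S\subseteq\lambda$ be stationary and ${\cal D}$ a normal filter on $\lambda$ with $S\in{\cal D}$ such that $\clubsuit^\ast_{-\mu}(S)/{\cal D}$ holds. Then ${\cal D}$ is not $\lambda^+$-saturated.
   Context: $LIM$ is the class of limit ordinals. A filter ${\cal D}$ on $\lambda$ is normal if it is $\lambda$-complete, contains all final segments of $\lambda$, and is closed under diagonal intersections $\Delta_{\alpha<\lambda}X_\alpha=\{\beta<\lambda:\forall\alpha<\beta\,(\beta\in X_\alpha)\}$. A set is ${\cal D}$-stationary if its complement is not in ${\cal D}$. ${\cal D}$ is $\lambda^+$-saturated iff there are no $\lambda^+$ many ${\cal D}$-stationary sets no two of which have ${\cal D}$-stationary intersection. $\clubsuit^\ast_{-\mu}(S)$ means: there is a sequence $\langle{\cal P}_\alpha:\alpha\in S\cap LIM\rangle$ such that each ${\cal P}_\alpha$ is a family of at most $|\alpha|$ unbounded subsets of $\alpha$, each $B\in{\cal P}_\alpha$ has order type $<\mu$, and for every $A\in[\lambda]^\lambda$ there is a club $C_A$ of $\lambda$ with $C_A\cap S\cap LIM\subseteq\{\alpha:\exists B\in{\cal P}_\alpha\,(\alpha=\sup(B\cap A))\}$. $\clubsuit^\ast_{-\mu}(S)/{\cal D}$ means the same, except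 that the requirement on each $A\in[\lambda]^\lambda$ is only that there is a set $C_A\in{\cal D}$ with $C_A\cap S\cap LIM\subseteq\{\alpha:\exists B\in{\cal P}_\alpha\,(\alpha=\sup(B\cap A))\}$. *)

(* Defs.v *)
(* plain set theory over a well-ordered type L representing lambda. *)
Set Implicit Arguments.

Section Defs.
Variable L : Type.
Variable lt : L -> L -> Prop.

Definition is_wellorder : Prop :=
  well_founded lt /\ (forall x y z, lt x y -> lt y z -> lt x z) /\
  (forall x y, lt x y \/ x = y \/ lt y x).

Definition cle (T U : Type) (A : T -> Prop) (B : U -> Prop) : Prop :=
  exists f : T -> U, (forall x, A x -> B (f x)) /\
    (forall x y, A x -> A y -> f x = f y -> x = y).
Definition clt (T U : Type) (A : T -> Prop) (B : U -> Prop) : Prop :=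
  cle A B /\ ~ cle B A.

Definition fullset : L -> Prop := fun _ => True.
(* the ordinal alpha < lambda as the set of its predecessors *)
Definition seg (a : L) : L -> Prop := fun b => lt b a.

Definition is_limit (a : L) : Prop :=
  (exists b, lt b a) /\ forall b, lt b a -> exists c, lt b c /\ lt c a.

Definition sup_eq (X : L -> Prop) (a : L) : Prop :=
  (forall x, X x -> lt x a) /\ (forall b, lt b a -> exists x, X x /\ lt b x).

(* the order type of B is < mu (mu represented by the ordinal m < lambda):
   B is order-isomorphic to some ordinal beta < mu *)
Definition otp_lt (B : L -> Prop) (m : L) : Prop :=
  exists b, lt b m /\ exists f : L -> L,
    (forall x y, B x -> B y -> lt x y -> lt (f x) (f y)) /\
    (forall x, B x -> lt (f x) b) /\
    (forall y, lt y b -> exists x, B x /\ f x = y).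

Definition unbounded (C : L -> Prop) : Prop := forall b, exists c, C c /\ lt b c.
Definition club (C : L -> Prop) : Prop :=
  unbounded C /\
  forall a, is_limit a -> (forall b, lt b a -> exists c, C c /\ lt b c /\ lt c a) -> C a.
Definition stationary (S : L -> Prop) : Prop :=
  forall C, club C -> exists a, C a /\ S a.

Definition setI (X Y : L -> Prop) : L -> Prop := fun a => X a /\ Y a.

Definition normal_filter (D : (L -> Prop) -> Prop) : Prop :=
  D fullset /\ ~ D (fun _ => False) /\
  (forall X Y, D X -> (forall a, X a -> Y a) -> D Y) /\
  (forall X Y, D X -> D Y -> D (setI X Y)) /\
  (forall (I : L -> Prop) (F : L -> L -> Prop), clt I fullset ->
     (forall i, I i -> D (F i)) -> D (fun a => forall i, I i -> F i a)) /\
  (forall a, D (fun b => lt a b \/ a = b)) /\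
  (forall F : L -> L -> Prop, (forall a, D (F a)) ->
     D (fun b => forall a, lt a b -> F a b)).

Definition D_stationary (D : (L -> Prop) -> Prop) (X : L -> Prop) : Prop :=
  ~ D (fun a => ~ X a).

(* lambda^+-saturated: no family of > lambda (i.e. >= lambda^+) many
   D-stationary sets with pairwise non-D-stationary intersections *)
Definition saturated_succ (D : (L -> Prop) -> Prop) : Prop :=
  ~ exists A : (L -> Prop) -> Prop,
      ~ cle A fullset /\ (forall X, A X -> D_stationary D X) /\
      (forall X Y, A X -> A Y -> X <> Y -> ~ D_stationary D (setI X Y)).

Definition clubstar_gen (m : L) (S : L -> Prop) (good : (L -> Prop) -> Prop) : Prop :=
  exists P : L -> (L -> Prop) -> Prop,
    (forall a, S a -> is_limit a ->
       cle (P a) (seg a) /\ forall B, P a B -> sup_eq B a /\ otp_lt B m) /\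
    (forall A : L -> Prop, cle fullset A ->
       exists C, good C /\ forall a, C a -> S a -> is_limit a ->
         exists B, P a B /\ sup_eq (setI B A) a).

Definition clubstar (m : L) (S : L -> Prop) : Prop := clubstar_gen m S club.
Definition clubstar_mod (m : L) (S : L -> Prop) (D : (L -> Prop) -> Prop) : Prop :=
  clubstar_gen m S D.

Definition lambda_succ_of_limit_cardinal (m : L) : Prop :=
  (forall b, lt b m -> clt (seg b) (seg m)) /\
  (exists b, is_limit b /\ (b = m \/ lt b m)) /\
  (forall b, lt b m -> exists c, lt c m /\ clt (seg b) (seg c)) /\
  (forall a, cle (seg a) (seg m)) /\ ~ cle fullset (seg m).
End Defs.

(* Main.v *)
From mathcomp Require Import ssreflect ssrfun ssrbool boolp classical_sets.
Require Import Defs.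

(** Suppose [D] is saturated, and let [K] be an almost disjoint family of more
than [lambda] unbounded subsets of [lambda].  For [D]-almost every [alpha] and
each [A] in [K], some member of [P_alpha] meets [A] cofinally in [alpha]; let
[T x A] be the set of [alpha] where the member numbered [x < mu] does.  By
saturation there are an [x] and a positive [X] below which, outside every
[Z] of size at most [lambda], some [T x A] is still positive.  Maximal antichains of such sets then
yield [lambda] many disjoint subfamilies of [K], each of size at most [lambda],
such that almost every [alpha] in [X] lies in the diagonal union of the [T x A]
over each subfamily.  Since [lambda] many members of [K] become disjoint after
removing bounded sets, at a suitable [alpha] the member of [P_alpha] numbered
[x] meets [mu] many disjoint sets, although its order type is less than [mu]. *)

(** * Cardinal comparison and maximal families *)

Lemma cle_sub (T : Type) (A B : T -> Prop) : (forall x, A x -> B x) -> cle A B.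
Proof. by move=> AB; exists id. Qed.

Lemma cle_trans {T U V : Type} {A : T -> Prop} {B : U -> Prop} {C : V -> Prop} :
  cle A B -> cle B C -> cle A C.
Proof.
move=> [f [fB fI]] [g [gC gI]]; exists (g \o f); split=> [x /fB /gC //|x y Ax Ay].
by move=> /(gI _ _ (fB _ Ax) (fB _ Ay)); apply: fI.
Qed.

Lemma maximal_pairwise (T : Type) (G : T -> Prop) (R : T -> T -> Prop) (U : T -> Prop) :
  (forall x y, R x y -> R y x) -> (forall x, U x -> G x) ->
  (forall x y, U x -> U y -> x <> y -> R x y) ->
  exists M : T -> Prop, [/\ forall x, U x -> M x, forall x, M x -> G x,
    forall x y, M x -> M y -> x <> y -> R x y &
    forall x, G x -> (forall y, M y -> x <> y -> R x y) -> M x].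
Proof.
move=> Rsym UG UR.
(* [U] is adjoined to [A] instead of being required inside it, because the union of the empty chain
   must satisfy [ok]. *)
pose ok (A : T -> Prop) := (forall x, A x -> G x) /\
  (forall x y, (A x \/ U x) -> (A y \/ U y) -> x <> y -> R x y).
have [|A [[AG AR] Amax]] := @Zorn_bigcup T ok.
  move=> F Fok Ftot; split=> [x [X /Fok[XG _] /XG]//|x y].
  have ch X Y : F X -> F Y -> exists2 Z, F Z & (X `<=` Z /\ Y `<=` Z)%classic.
    move=> FX FY; case: (Ftot X Y FX FY) => [XY|YX].
      by exists Y => //; split.
    by exists X => //; split.
  case=> [[X FX Xx]|Ux] [[Y FY Yy]|Uy] xy.
  - have [Z /Fok[_ ZR] [XZ YZ]] := ch _ _ FX FY.
    by apply: ZR => //; left; [apply: XZ|apply: YZ].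
  - by have [_ XR] := Fok _ FX; apply: XR => //; [left|right].
  - by have [_ YR] := Fok _ FY; apply: YR => //; [right|left].
  - exact: UR.
exists (fun x => A x \/ U x); split=> [x|x [/AG|/UG]||x Gx xR] //; first by right.
apply: contrapT => nx; apply: (Amax (fun y => A y \/ y = x)).
  split; first by move=> y; left.
  by move=> /(_ x (or_intror erefl)) Ax; apply: nx; left.
split=> [y [/AG//|->//]|y z Hy Hz yz].
have sp u : (A u \/ u = x) \/ U u -> u = x \/ (A u \/ U u) by tauto.
case/sp: Hy => [yx|Hy]; case/sp: Hz => [zx|Hz].
- by case: yz; rewrite yx zx.
- by subst y; apply: xR.
- by subst z; apply: Rsym; apply: xR => // /esym.
- exact: AR.
Qed.

(** * Well-orders and transfinite recursion *)

Section WellOrder.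
Context {L : Type} {lt : L -> L -> Prop}.
Hypothesis Hwo : is_wellorder lt.

Lemma lt_trans {x y z} : lt x y -> lt y z -> lt x z.
Proof. by case: Hwo => _ [+ _]; apply. Qed.

Lemma lt_irr x : ~ lt x x.
Proof. by case: Hwo => wf _; elim: x / (wf x) => x _ IH xx; apply: (IH x). Qed.

Lemma lt_total x y : lt x y \/ x = y \/ lt y x.
Proof. by case: Hwo => _ [_]; apply. Qed.

Lemma nlt_lt_trans {x y z} : ~ lt y x -> lt y z -> lt x z.
Proof. by case: (lt_total x y) => [xy _|[->//|//]]; apply: lt_trans. Qed.

Lemma least (X : L -> Prop) : (exists x, X x) -> exists x, X x /\ forall y, X y -> ~ lt y x.
Proof.
case: Hwo => wf _ [x]; elim: x / (wf x) => x _ IH Xx.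
have [[y [Xy yx]]|nex] := EM (exists y, X y /\ lt y x); first exact: IH yx Xy.
by exists x; split=> // y Xy yx; apply: nex; exists y.
Qed.

Lemma transfinite_choice (T : Type) (t0 : T) (R : (T -> Prop) -> T -> Prop) :
  (forall a (f : L -> T), exists t, R (fun z => exists b, lt b a /\ z = f b) t) ->
  exists f : L -> T, forall a, R (fun z => exists b, lt b a /\ z = f b) (f a).
Proof.
move=> H.
have /choice[G HG] : forall p : L * (L -> T), exists t,
  R (fun z => exists b, lt b p.1 /\ z = p.2 b) t by case=> a f; apply: H.
(* [G] expects total functions, so [ext] fills the values not yet defined with [t0]; [R] never looks
   at them. *)
pose ext a (r : forall b, lt b a -> T) b :=
  match pselect (lt b a) with left h => r b h | right _ => t0 end.
pose f := Fix (proj1 Hwo) (fun _ => T) (fun a r => G (a, ext a r)).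
have fE a : f a = G (a, ext a (fun b _ => f b)).
  rewrite /f Fix_eq // => x r s rs; congr (G (_, _)); apply/funext => b.
  by rewrite /ext; case: pselect => // h; apply: rs.
exists f => a; rewrite fE; have /= := HG (a, ext a (fun b _ => f b)).
congr R; apply/funext => z; apply/propext.
by split=> -[b [ba ->]]; exists b; split=> //; rewrite /ext; case: pselect.
Qed.

End WellOrder.

(** * Sizes of initial segments of a successor cardinal *)

Section Successor.
Context {L : Type} {lt : L -> L -> Prop} {m : L}.
Hypothesis Hwo : is_wellorder lt.
Hypothesis Hcard : lambda_succ_of_limit_cardinal lt m.

Lemma cle_seg_m a : cle (seg lt a) (seg lt m).
Proof. by case: Hcard => _ [_ [_ [+ _]]]; apply. Qed.

Lemma full_not_cle_seg a : ~ cle (@fullset L) (seg lt a).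
Proof.
move=> fa; case: Hcard => _ [_ [_ [_ +]]]; apply.
exact: cle_trans fa (cle_seg_m a).
Qed.

Lemma clt_seg_full a : clt (seg lt a) (@fullset L).
Proof. by split; [exact: cle_sub|exact: full_not_cle_seg]. Qed.

(* Hilbert's hotel: an infinite cardinal does not grow when one point is added. *)
Lemma no_max a : exists b, lt a b.
Proof.
apply: contrapT => amax.
have lta x : x <> a -> lt x a.
  by case: (lt_total Hwo x a) => [//|[//|ax]]; case: amax; exists x.
case: (Hcard) => _ [[l [[l0 llim] lm]] [_ [_]]]; apply.
have [o [_ omin]] := least Hwo (fun=> True) (ex_intro _ m I).
have {l0} ol : lt o l.
  by case: l0 => b bl; case: (lt_total Hwo o l) => [//|[ol|lo]];
    [case: (omin b I); rewrite ol|case: (omin l I)].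
have {}lm x : lt x l -> lt x m by case: lm => [->//|lm xl]; apply: (lt_trans Hwo) lm.
have /choice[s Hs] : forall x, exists y, lt x l ->
    [/\ lt x y, lt y l & forall z, lt x z -> ~ lt z y].
  move=> x; have [xl|] := EM (lt x l); last by move=> nx; exists x.
  have [c [xc cl]] := llim x xl.
  have [y [xy ymin]] := least Hwo (lt x) (ex_intro _ c xc).
  exists y => _; split=> //.
  by apply: (nlt_lt_trans Hwo) cl; apply: ymin.
have [f [fm fI]] := cle_seg_m a.
pose hop y := if pselect (lt y l) then s y else y.
have hopm y : lt y m -> lt (hop y) m.
  by rewrite /hop; case: pselect => // yl _; apply: lm; case: (Hs y yl).
have ohop y : o <> hop y.
  rewrite /hop; case: pselect => [yl|nyl] /= oE; last by apply: nyl; rewrite -oE.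
  by have [+ _ _] := Hs y yl; rewrite -oE; apply: omin.
have hopI x y : hop x = hop y -> x = y.
  rewrite /hop; case: pselect => xl; case: pselect => yl //= sE.
  - have [xs _ smin] := Hs x xl; have [ys _ smin'] := Hs y yl.
    case: (lt_total Hwo x y) => [xy|[//|yx]].
      by case: (smin y xy); rewrite sE.
    by case: (smin' x yx); rewrite -sE.
  - by case: yl; rewrite -sE; case: (Hs x xl).
  - by case: xl; rewrite sE; case: (Hs y yl).
exists (fun x => if pselect (x = a) then o else hop (f x)); split=> [x _|x y _ _].
  by case: pselect => [xa|/lta/fm/hopm //]; apply: lm.
case: pselect => xa; case: pselect => ya /=; first by rewrite xa ya.
- by move/ohop.
- by move/esym/ohop.
- by move/hopI; apply: fI; apply: lta.
Qed.

Lemma cle_full_unbounded (X : L -> Prop) : cle (@fullset L) X -> unbounded lt X.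
Proof.
move=> fX b; apply: contrapT => Xb; have [c bc] := no_max b.
apply: (full_not_cle_seg c); apply: cle_trans fX _; apply: cle_sub => x Xx.
by apply: (nlt_lt_trans Hwo) bc => bx; apply: Xb; exists x.
Qed.

(** * Normal filters, regularity and pairing *)

Section Filter.
Context {D : (L -> Prop) -> Prop}.
Hypothesis HD : normal_filter lt D.

Lemma D_full : D (@fullset L).
Proof. by case: HD. Qed.

Lemma D_mono {X Y : L -> Prop} : (forall a, X a -> Y a) -> D X -> D Y.
Proof. by move=> XY DX; case: HD => _ [_ [+ _]]; apply; [exact: DX|]. Qed.

Lemma D_and {X Y : L -> Prop} : D X -> D Y -> D (fun a => X a /\ Y a).
Proof. by case: HD => _ [_ [_ [+ _]]]; apply. Qed.

Lemma D_nonempty {X : L -> Prop} : D X -> exists x, X x.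
Proof.
move=> DX; apply: contrapT => nX; case: HD => _ [+ _]; apply.
by apply: D_mono DX => x Xx; apply: nX; exists x.
Qed.

Lemma D_seg (b : L) (F : L -> L -> Prop) :
  (forall i, lt i b -> D (F i)) -> D (fun a => forall i, lt i b -> F i a).
Proof. by case: HD => _ [_ [_ [_ [+ _]]]]; apply; exact: clt_seg_full. Qed.

Lemma D_diag (F : L -> L -> Prop) :
  (forall a, D (F a)) -> D (fun b => forall a, lt a b -> F a b).
Proof. by case: HD => _ [_ [_ [_ [_ [_ ]]]]]; apply. Qed.

Lemma D_tail a : D (lt a).
Proof.
have [b ab] := no_max a; case: HD => _ [_ [_ [_ [_ [/(_ b) + _]]]]].
by apply: D_mono => x [bx|<-//]; apply: (lt_trans Hwo) bx.
Qed.

(** The closure points of [h] form a diagonal intersection of tails. *)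
Lemma D_closed (h : L -> L) : D (fun b => forall a, lt a b -> lt (h a) b).
Proof. by apply: D_diag => a; apply: D_tail. Qed.

Lemma D_limit : D (is_limit lt).
Proof.
have /choice[s Hs] := no_max.
apply: D_mono (D_and (D_closed s) (D_tail m)) => a [sa ma].
by split=> [|b ba]; [exists m|exists (s b); split; [exact: Hs|exact: sa]].
Qed.

(** If [s b] is a member of [C] above [b], then a limit ordinal closed under [s] is a limit of
    members of [C]. *)
Lemma club_D (C : L -> Prop) : club lt C -> D C.
Proof.
move=> [Cunb Ccl]; have /choice[s Hs] := Cunb.
apply: D_mono (D_and (D_closed s) D_limit) => a [sa la].
apply: Ccl la _ => b ba; have [Cs bs] := Hs b.
by exists (s b); split=> //; split=> //; apply: sa.
Qed.

(* [lambda] is regular because [D] is [lambda]-complete. *)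
Lemma regular (Q : L -> L -> Prop) a :
  (forall i b c, Q i b -> lt b c -> Q i c) ->
  (forall i, lt i a -> exists b, Q i b) ->
  exists c, forall i, lt i a -> Q i c.
Proof.
move=> Qmono Qex.
have /choice[h Hh] : forall i, exists b, lt i a -> Q i b.
  by move=> i; have [/Qex[b Qb]|] := EM (lt i a); [exists b|exists i].
have [c Hc] := D_nonempty (D_seg a (fun i => lt (h i)) (fun i _ => D_tail (h i))).
by exists c => i ia; apply: Qmono (Hh i ia) (Hc i ia).
Qed.

Lemma unbounded_increasing (X : L -> Prop) : unbounded lt X ->
  exists f : L -> L, (forall a, X (f a)) /\ forall a b, f a = f b -> a = b.
Proof.
move=> Xunb.
have [|f Hf] := @transfinite_choice _ _ Hwo _ m
  (fun Z t => X t /\ forall z, Z z -> lt z t).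
  move=> a f; have [||c Hc] := regular (fun i c => lt (f i) c) a.
  - by move=> i b c; apply: (lt_trans Hwo).
  - by move=> i _; apply: no_max.
  have [t [Xt ct]] := Xunb c; exists t; split=> // _ [b [ba ->]].
  by apply: (lt_trans Hwo) ct; apply: Hc.
have finc a b : lt a b -> lt (f a) (f b).
  by move=> ab; have [_] := Hf b; apply; exists a.
exists f; split=> [a|a b fE]; first by case: (Hf a).
by case: (lt_total Hwo a b) => [/finc|[//|/finc]]; rewrite fE => /(lt_irr Hwo).
Qed.

(* Ulam's matrix gives [lambda] many disjoint unbounded sets, hence an injection
   of [lambda * lambda] into [lambda]. *)
Lemma pairing : exists p : L -> L -> L, forall a b c d, p a b = p c d -> a = c /\ b = d.
Proof.
have /choice[e He] := cle_seg_m.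
pose U i b a := lt b a /\ e a b = i.
have Udisj i b b' a : U i b a -> U i b' a -> b = b'.
  by move=> [ba <-] [ba' /esym]; case: (He a) => _; apply.
(* Every ordinal above [b] lies in some [U i b] with [i < m]; were all of these bounded, regularity
   would bound them together. *)
have Uunb b : exists i, lt i m /\ unbounded lt (U i b).
  apply: contrapT => nU.
  have [||c Hc] := regular (fun i c => forall x, U i b x -> ~ lt c x) m.
  - move=> i c d Hc cd x /Hc cx dx; apply: cx; exact: (lt_trans Hwo) cd dx.
  - move=> i im; apply: contrapT => nb; apply: nU; exists i; split=> // c.
    apply: contrapT => nc; apply: nb; exists c => x Ux cx; apply: nc; by exists x.
  have [x [bx cx]] := D_nonempty (D_and (D_tail b) (D_tail c)).
  by apply: (Hc (e x b) _ x) cx; [case: (He x) => + _; apply|split].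
have [k Hk] := choice Uunb.
(* Regularity again: [k] takes values below [m], so some value [i] is taken unboundedly often. *)
have [i iunb] : exists i, unbounded lt (fun b => k b = i).
  apply: contrapT => nk.
  have [||c Hc] := regular (fun i c => forall b, k b = i -> ~ lt c b) m.
  - move=> i c d Hc cd x /Hc cx dx; apply: cx; exact: (lt_trans Hwo) cd dx.
  - move=> i im; apply: contrapT => nb; apply: nk; exists i => c.
    by apply: contrapT => nc; apply: nb; exists c => x Ux cx; apply: nc; exists x.
  have [d cd] := no_max c; apply: (Hc (k d)) cd => //.
  by case: (Hk d).
have [f [fk fI]] := unbounded_increasing _ iunb.
have /choice[u Hu] : forall a, exists u : L -> L,
    (forall b, U i (f a) (u b)) /\ forall b c, u b = u c -> b = c.
  by move=> a; apply: unbounded_increasing; rewrite -[in U i](fk a); case: (Hk (f a)).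
exists u => a b c d uE.
have ac : a = c.
  apply: fI; have [Ua _] := Hu a; have [Uc _] := Hu c.
  by apply: Udisj (Ua b) _; rewrite uE.
by split=> //; subst c; have [_] := Hu a; apply.
Qed.

Lemma cle_coded (T : Type) (Z : T -> Prop) (Q : L -> L -> T -> Prop) :
  (forall z, Z z -> exists a b, Q a b z) ->
  (forall a b z z', Q a b z -> Q a b z' -> z = z') -> cle Z (@fullset L).
Proof.
move=> Zex Qfun; have [p pI] := pairing.
have /choice[c Hc] : forall z, exists c : L * L, Z z -> Q c.1 c.2 z.
  move=> z; have [/Zex[a [b Qab]]|nZ] := EM (Z z); first by exists (a, b).
  by exists (m, m).
exists (fun z => p (c z).1 (c z).2); split=> // x y /Hc Qx /Hc Qy /pI[E1 E2].
by apply: Qfun Qx _; rewrite E1 E2.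
Qed.

Lemma cle_bigcup (I T : Type) (J : I -> Prop) (F : I -> T -> Prop) :
  cle J (@fullset L) -> (forall i, J i -> cle (F i) (@fullset L)) ->
  cle (fun z => exists i, J i /\ F i z) (@fullset L).
Proof.
move=> [c [_ cI]] Fsmall.
have /choice[d Hd] : forall i, exists d : T -> L,
    J i -> forall x y, F i x -> F i y -> d x = d y -> x = y.
  by move=> i; have [/Fsmall[d [_ dI]]|] := EM (J i); [exists d|exists (fun=> m)].
apply: (@cle_coded _ _ (fun a b z => exists i, [/\ J i, F i z, c i = a & d i z = b])).
  by move=> z [i [Ji Fz]]; exists (c i), (d i z), i.
move=> a b z z' [i [Ji Fz <- <-]] [j [Jj Fz' /cI ij /esym]].
by move: Fz'; rewrite ij // => Fz'; apply: Hd.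
Qed.

(** * Almost disjoint families *)

Definition almost_disjoint (X Y : L -> Prop) : Prop :=
  exists b, forall x, X x -> Y x -> ~ lt b x.

Lemma almost_disjoint_sym X Y : almost_disjoint X Y -> almost_disjoint Y X.
Proof. by move=> [b Hb]; exists b => x Yx Xx; apply: Hb. Qed.

(** Number [Z] by [c]. By regularity one bound [g X] works for the intersections of [X] with all
    members numbered below it. *)
Lemma disjoint_tails (Z : (L -> Prop) -> Prop) :
  cle Z (@fullset L) ->
  (forall X Y, Z X -> Z Y -> X <> Y -> almost_disjoint X Y) ->
  exists g : (L -> Prop) -> L, forall X Y x, Z X -> Z Y -> X x -> Y x ->
    lt (g X) x -> lt (g Y) x -> X = Y.
Proof.
move=> [c [_ cI]] Zad.
have /choice[g Hg] : forall X, exists b, Z X -> forall Y x, Z Y -> lt (c Y) (c X) ->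
    X x -> Y x -> ~ lt b x.
  move=> X; have [ZX|] := EM (Z X); last by exists m.
  have [||b Hb] := regular
      (fun i b => forall Y x, Z Y -> c Y = i -> lt i (c X) -> X x -> Y x -> ~ lt b x) (c X).
  - move=> i b d Hb bd Y x ZY cY iX Xx Yx dx.
    by apply: (Hb Y x) => //; apply: (lt_trans Hwo) bd dx.
  - move=> i iX; have [[Y [ZY cY]]|nY] := EM (exists Y, Z Y /\ c Y = i).
      have [|b Hb] := Zad X Y ZX ZY.
        by move=> E; move: iX; rewrite E cY; apply: (lt_irr Hwo).
      by exists b => Y' x ZY' cY' _ Xx Y'x; apply: Hb => //; rewrite (cI Y Y') // cY.
    by exists m => Y x ZY cY; case: nY; exists Y.
  by exists b => _ Y x ZY YX; apply: (Hb _ YX).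
exists g => X Y x ZX ZY Xx Yx gX gY; apply: cI => //.
case: (lt_total Hwo (c X) (c Y)) => [XY|[//|YX]].
  by case: (Hg Y ZY X x).
by case: (Hg X ZX Y x).
Qed.

(** Extend the disjoint sets [col a] to a maximal family. If some [c] numbered it by ordinals below
    lambda, a diagonal set would contradict maximality. *)
Lemma large_almost_disjoint_family : exists K : (L -> Prop) -> Prop,
  [/\ forall X, K X -> cle (@fullset L) X,
      forall X Y, K X -> K Y -> X <> Y -> almost_disjoint X Y &
      ~ cle K (@fullset L)].
Proof.
have [p pI] := pairing.
pose col a x := exists b, x = p a b.
have [|||K [colK Kunb Kad Kmax]] := @maximal_pairwise _ (fun X => cle (@fullset L) X)
    almost_disjoint (fun X => exists a, X = col a).
- exact: almost_disjoint_sym.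
- move=> _ [a ->]; exists (p a); split=> [b _|b c _ _ /pI[]//]; by exists b.
- move=> _ _ [a ->] [b ->] ab; exists m => _ [d ->] [d' /pI[E _]].
  by case: ab; rewrite E.
exists K; split=> // -[c [_ cI]].
have colI a b : col a = col b -> a = b.
  move=> E; have : col b (p a m) by rewrite -E; exists m.
  by case=> d /pI[].
have /choice[x Hx] : forall b, exists x, lt b x /\ forall X, K X -> lt (c X) b -> ~ X x.
  move=> b.
  (* There are too many columns for all to be numbered below [b]. One that is not meets each member
     numbered below [b] in a bounded set, so it has points beyond all these intersections. *)
  have [a cab] : exists a, ~ lt (c (col a)) b.
    apply: contrapT => na; apply: (full_not_cle_seg b).
    exists (fun a => c (col a)); split=> [a _|a a' _ _ /cI E].
      by apply: contrapT => nc; apply: na; exists a.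
    by apply: colI; apply: E; apply: colK; [exists a|exists a'].
  have Kcol : K (col a) by apply: colK; exists a.
  have [||d Hd] := regular (fun i d => forall X x, K X -> c X = i -> lt i b ->
      col a x -> X x -> ~ lt d x) b.
  - move=> i d d' Hd dd' X x KX cX ib ax Xx d'x.
    by apply: (Hd X x) => //; apply: (lt_trans Hwo) dd' d'x.
  - move=> i ib; have [[X [KX cX]]|nX] := EM (exists X, K X /\ c X = i).
      have [|d Hd] := Kad (col a) X Kcol KX.
        by move=> E; apply: cab; rewrite E cX.
      by exists d => Y x KY cY _ ax Yx; apply: Hd => //; rewrite (cI X Y) // cX.
    by exists m => X x KX cX; case: nX; exists X.
  have colu := cle_full_unbounded _ (Kunb _ Kcol).
  have [e [be de]] := D_nonempty (D_and (D_tail b) (D_tail d)).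
  have [x [ax ex]] := colu e.
  exists x; split=> [|X KX Xb Xx]; first exact: (lt_trans Hwo) be ex.
  by apply: (Hd _ Xb X x KX) => //; apply: (lt_trans Hwo) de ex.
pose V y := exists b, y = x b.
have Vunb : unbounded lt V.
  by move=> b; exists (x b); split; [exists b|case: (Hx b)].
have Vfull : cle (@fullset L) V.
  by have [f [fV fI]] := unbounded_increasing _ Vunb; exists f; split=> // ? ? _ _; apply: fI.
(* If [x b] is in [X], then [b] is at most [c X]; so only boundedly many [b] matter. *)
have Vad X : K X -> almost_disjoint V X.
  move=> KX; have [s cs] := no_max (c X).
  have [||d Hd] := regular (fun i d => ~ lt d (x i)) s.
  - by move=> i d d' nd dd' d'x; apply: nd; apply: (lt_trans Hwo) dd' d'x.
  - by move=> i _; exists (x i); apply: lt_irr.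
  exists d => _ [b ->] Xx dx; have [_ /(_ X KX) nX] := Hx b.
  apply: (Hd b) dx; apply: (nlt_lt_trans Hwo) cs => /nX; exact.
(* Maximality puts [V] in [K], which makes [V] almost disjoint from itself although it is
   unbounded. *)
have KV : K V by apply: Kmax => // X KX _; apply: Vad.
have [b Hb] := Vad V KV; have [y [Vy ly]] := Vunb b.
exact: (Hb y Vy Vy ly).
Qed.

(** * Positive sets and antichains *)

Notation pos := (D_stationary D).

Lemma not_pos (X : L -> Prop) : ~ pos X -> D (fun a => ~ X a).
Proof. exact: contrapT. Qed.

Lemma pos_mono {X Y : L -> Prop} : (forall a, X a -> Y a) -> pos X -> pos Y.
Proof. by move=> XY pX DY; apply: pX; apply: D_mono DY => a nY /XY. Qed.

Lemma pos_D {X E : L -> Prop} : pos X -> D E -> pos (setI X E).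
Proof.
move=> pX DE DXE; apply: pX; apply: D_mono (D_and DXE DE) => a [nXE Ea] Xa.
by apply: nXE.
Qed.

Lemma pos_nonempty {X : L -> Prop} : pos X -> exists x, X x.
Proof.
move=> pX; apply: contrapT => nX; apply: pX.
by apply: D_mono D_full => a _ Xa; apply: nX; exists a.
Qed.

Hypothesis Hsat : saturated_succ D.

(** Zorn's lemma gives maximality; saturation bounds the size. *)
Lemma maximal_antichain (G : (L -> Prop) -> Prop) : (forall X, G X -> pos X) ->
  exists M : (L -> Prop) -> Prop, [/\ forall X, M X -> G X, cle M (@fullset L) &
    forall X, G X -> (forall Y, M Y -> ~ pos (setI X Y)) -> False].
Proof.
move=> Gpos.
have [||//|M [_ MG Mdisj Mmax]] := @maximal_pairwise _ G
  (fun X Y => ~ pos (setI X Y)) (fun=> False) => //.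
  by move=> X Y + pYX; apply; apply: pos_mono pYX => a [].
exists M; split=> //.
  apply: contrapT => nM; apply: Hsat; exists M; split=> //; split=> // X /MG /Gpos //.
move=> X GX XM; have MX : M X by apply: Mmax => // Y MY _; apply: XM.
by apply: (XM X MX); apply: pos_mono (Gpos X GX).
Qed.

(** * Dense families and diagonal covers *)

Section Families.
Variables (I : Type) (K : I -> Prop).

(** In forcing terms: [X] forces some [T i], with [i] in [K] outside [Z], into the generic
    ultrafilter. *)
Definition dense_below (T : I -> L -> Prop) (Z : I -> Prop) (X : L -> Prop) : Prop :=
  forall Y, pos Y -> (forall a, Y a -> X a) -> exists i, [/\ K i, ~ Z i & pos (setI Y (T i))].

(* In forcing terms: either some condition forces [lambda^+] many [T i] into the
   generic ultrafilter, or all but [lambda] many of the [T i] are null. *)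
Lemma dense_below_or_null (T : I -> L -> Prop) :
  (exists X, pos X /\ forall Z, cle Z (@fullset L) -> dense_below T Z X) \/
  (exists Z, cle Z (@fullset L) /\ forall i, K i -> ~ Z i -> ~ pos (T i)).
Proof.
apply: contrapT => /not_orP[nX nZ].
(* These are the positive sets on which all but at most lambda many [T i] are null; failure of the
   first alternative makes them dense. *)
pose G X := pos X /\ exists Z, cle Z (@fullset L) /\
  forall i, K i -> ~ Z i -> ~ pos (setI X (T i)).
have Gdense X : pos X -> exists Y, G Y /\ forall a, Y a -> X a.
  move=> pX; apply: contrapT => nY; apply: nX; exists X; split=> // Z Zs Y pY YX.
  apply: contrapT => ni; apply: nY; exists Y; split=> //; split=> //.
  by exists Z; split=> // i Ki Zi pi; apply: ni; exists i.
have [X []//|M [MG Ms Mmax]] := maximal_antichain G.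
have /choice[ZM HZM] : forall X, exists Z, M X -> cle Z (@fullset L) /\
    forall i, K i -> ~ Z i -> ~ pos (setI X (T i)).
  move=> X; have [/MG[_ [Z HZ]]|] := EM (M X); first by exists Z.
  by exists (fun=> False).
(* For [i] outside all exceptional sets [ZM X], a positive [T i] would contain a member of [G]
   incompatible with all of [M]. *)
apply: nZ; exists (fun i => exists X, M X /\ ZM X i); split.
  by apply: cle_bigcup => // X /HZM[].
move=> i Ki nZ /Gdense[Y [GY YT]]; apply: (Mmax Y GY) => X MX pYX.
have [_ /(_ i Ki)] := HZM X MX; apply.
  by move=> Zi; apply: nZ; exists X.
by apply: pos_mono pYX => a [/YT].
Qed.

(** Otherwise each [x] has a small exceptional set, and these do not exhaust [K]. An [i] outside
    them has every [T x i] null, against the completeness of [D]. *)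
Lemma exists_dense_below (T : L -> I -> L -> Prop) : ~ cle K (@fullset L) ->
  (forall i, K i -> D (fun a => exists x, lt x m /\ T x i a)) ->
  exists x X, pos X /\ forall Z, cle Z (@fullset L) -> dense_below (T x) Z X.
Proof.
move=> Kbig KT; apply: contrapT => nx.
have /choice[Z HZ] : forall x, exists Z, cle Z (@fullset L) /\
    forall i, K i -> ~ Z i -> ~ pos (T x i).
  by move=> x; case: (dense_below_or_null (T x)) => // -[X HX]; case: nx; exists x, X.
apply: Kbig; apply: (@cle_trans _ _ _ _ (fun i => exists x, @fullset L x /\ Z x i)); last first.
  by apply: cle_bigcup => [|x _]; [exact: cle_sub|case: (HZ x)].
apply: cle_sub => i Ki; apply: contrapT => nZ.
have Dnull : D (fun a => forall x, lt x m -> ~ T x i a).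
  apply: D_seg => x _; apply: not_pos; have [_] := HZ x; apply=> // Zi.
  by apply: nZ; exists x.
have [a [nT [x [xm Ta]]]] := D_nonempty (D_and Dnull (KT i Ki)).
exact: nT Ta.
Qed.

(** Take a maximal antichain of positive parts of [X], each inside some [T i]; [w h] is the index
    [i] for the part numbered [h]. *)
Lemma diagonal_cover (T : I -> L -> Prop) (Z : I -> Prop) (X : L -> Prop) :
  pos X -> dense_below T Z X ->
  exists w : L -> I, (forall h, K (w h) /\ ~ Z (w h)) /\
    D (fun a => X a -> exists h, lt h a /\ T (w h) a).
Proof.
move=> pX Xdense.
pose G Y := [/\ pos Y, forall a, Y a -> X a & exists i, [/\ K i, ~ Z i & forall a, Y a -> T i a]].
have [Y []//|M [MG [c [_ cI]] Mmax]] := maximal_antichain G.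
have /choice[w Hw] : forall h, exists i, (K i /\ ~ Z i) /\
    forall Y, M Y -> c Y = h -> forall a, Y a -> T i a.
  move=> h; have [[Y [MY cY]]|nY] := EM (exists Y, M Y /\ c Y = h).
    have [_ _ [i [Ki Zi YT]]] := MG Y MY; exists i; split=> // Y' MY' cY'.
    by rewrite (cI Y' Y) // cY.
  have [//|i [Ki Zi _]] := Xdense X pX.
  by exists i; split=> // Y MY cY; case: nY; exists Y.
exists w; split=> [h|]; first by case: (Hw h).
apply: contrapT => nD.
have pY : pos (fun a => X a /\ forall h, lt h a -> ~ T (w h) a).
  move=> DY; apply: nD; apply: D_mono DY => a nY Xa; apply: contrapT => nh.
  by apply: nY; split=> // h ha Th; apply: nh; exists h.
have [|i [Ki Zi pYi]] := Xdense _ pY; first by move=> a [].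
apply: (Mmax _ (And3 pYi _ _)).
- by move=> a [[]].
- by exists i; split=> // a [].
(* Beyond [c Y], every point of [Y] is covered by [T (w (c Y))], so the uncovered set meets [Y] in a
   bounded set. *)
move=> Y MY pYY; apply: (pos_D pYY (D_tail (c Y))).
apply: D_mono D_full => a _ [[[[_ nT] _] Ya] ca].
by apply: (nT _ ca); have [_ /(_ Y MY erefl)] := Hw (c Y); apply.
Qed.

(** Recursion on [z]: the indices in earlier covers number at most lambda, so they can be excluded
    through [Z]. *)
Lemma disjoint_diagonal_covers (T : I -> L -> Prop) (X : L -> Prop) :
  pos X -> (forall Z, cle Z (@fullset L) -> dense_below T Z X) ->
  exists w : L -> L -> I, [/\ forall z h, K (w z h),
    forall z h z' h', w z h = w z' h' -> z = z' &
    forall z, D (fun a => X a -> exists h, lt h a /\ T (w z h) a)].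
Proof.
move=> pX Xdense.
have cover Z : cle Z (@fullset L) -> _ := fun Zs => diagonal_cover T Z X pX (Xdense Z Zs).
have [|w0 _] := cover (fun=> False); first by exists (fun=> m).
have [|w Hw] := @transfinite_choice _ _ Hwo _ w0 (fun V v =>
    [/\ forall h, K (v h), forall u h h', V u -> v h <> u h' &
        D (fun a => X a -> exists h, lt h a /\ T (v h) a)]).
  move=> a f; have [|v [vK vD]] := cover (fun i => exists b h, i = f b h).
    apply: (cle_coded _ _ (fun b h i => i = f b h)) => // b h z z' -> -> //.
  exists v; split=> // [h|u h h' [b [_ ->]] E]; first by case: (vK h).
  by case: (vK h) => _; apply; exists b, h'.
have wdisj z z' h h' : lt z' z -> w z h <> w z' h'.
  by move=> zz'; case: (Hw z) => _ + _; apply; exists z'.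
exists w; split=> [z|z h z' h' E|z]; [by case: (Hw z)| |by case: (Hw z)].
case: (lt_total Hwo z z') => [zz'|[//|zz']].
  by case: (wdisj _ _ h' h zz').
by case: (wdisj _ _ h h' zz').
Qed.

End Families.

(** * The contradiction at a single ordinal *)

Lemma clubstar_mod_not_saturated (S : L -> Prop) : D S -> clubstar_mod lt m S D -> False.
Proof.
move=> DS [P [Psmall Pguess]].
have [K [Kfull Kad Kbig]] := large_almost_disjoint_family.
have /choice[e He] : forall a, exists e : (L -> Prop) -> L, S a -> is_limit lt a ->
    (forall B, P a B -> lt (e B) m) /\ forall B B', P a B -> P a B' -> e B = e B' -> B = B'.
  move=> a; have [[Sa la]|n] := EM (S a /\ is_limit lt a); last first.
    by exists (fun=> m) => Sa la; case: n.
  have [Pa _] := Psmall a Sa la; have [f [fm fI]] := cle_trans Pa (cle_seg_m a).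
  by exists f.
pose T x A a := [/\ S a, is_limit lt a & exists B, [/\ P a B, e a B = x & sup_eq lt (setI B A) a]].
have [|x [X [pX Xdense]]] := exists_dense_below _ K T Kbig.
  move=> A /Kfull /Pguess[C [DC HC]].
  apply: D_mono (D_and DC (D_and DS D_limit)) => a [Ca [Sa la]].
  have [B [PB supB]] := HC a Ca Sa la.
  exists (e a B); split; first by have [+ _] := He a Sa la; apply.
  by split=> //; exists B.
have [w [wK wI wD]] := disjoint_diagonal_covers _ _ _ _ pX Xdense.
pose Z A := exists z h, A = w z h.
have [||g Hg] := disjoint_tails Z.
- by apply: (cle_coded _ _ (fun b h i => i = w b h)) => // b h z z' -> -> //.
- by move=> _ _ [z [h ->]] [z' [h' ->]]; apply: Kad.
(* Only the first [m] covers are used, so completeness of [D] handles them all at once. *)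
have Dcov := D_seg m _ (fun z _ => wD z).
have Dg := D_seg m _ (fun z _ => D_closed (fun h => g (w z h))).
have [a [Xa [[acov ag] [Sa la]]]] := pos_nonempty (pos_D pX
  (D_and (D_and Dcov Dg) (D_and DS D_limit))).
have [em eI] := He a Sa la.
(* Since [a] is closed under [g (w z h)], a set cofinal in [a] has points past that bound. *)
have hit z : lt z m -> exists h B y, [/\ P a B, e a B = x, B y, w z h y & lt (g (w z h)) y].
  move=> zm; have [h [ha [_ _ [B [PB eB [_ Bsup]]]]]] := acov z zm Xa.
  have [y [[By wy] gy]] := Bsup _ (ag z zm h ha).
  by exists h, B, y.
have [o om] : exists o, lt o m.
  case: (Hcard) => _ [[l [[[o ol] _] [<-|lm]]] _]; first by exists o.
  by exists l.
(* Injectivity of [e a] makes the [B] numbered [x] the same for every [z]. *)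
have [_ [B [_ [PB eB _ _ _]]]] := hit o om.
have /choice[y Hy] : forall z, exists y, lt z m -> B y /\ exists h, w z h y /\ lt (g (w z h)) y.
  move=> z; have [/hit[h [B' [y [PB' eB' By wy gy]]]]|] := EM (lt z m); last by exists m.
  exists y => _; split; last by exists h.
  by rewrite (eI B B') // eB.
(* A common point of two tails identifies the indices, and disjointness of the covers then gives
   [z = z']. *)
have mB : cle (seg lt m) B.
  exists y; split=> [z /Hy[]//|z z' /Hy[_ [h [wz gz]]] /Hy[_ [h' [wz' gz']]] yE].
  rewrite -yE in wz' gz'.
  by apply: wI; apply: (Hg _ _ (y z) _ _ wz wz' gz gz'); [exists z, h|exists z', h'].
have [_ /(_ B PB)[_ [b [bm [f [finc [fb _]]]]]]] := Psmall a Sa la.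
case: (Hcard) => /(_ b bm)[_ nmb] _; apply: nmb; apply: cle_trans mB _.
exists f; split=> // u v Bu Bv fE; case: (lt_total Hwo u v) => [uv|[//|vu]].
  by case: (lt_irr Hwo (f u)); rewrite {2}fE; apply: finc.
by case: (lt_irr Hwo (f u)); rewrite {1}fE; apply: finc.
Qed.

End Filter.
End Successor.

Theorem theorem2p5 (L : Type) (lt : L -> L -> Prop) (m : L)
  (Hwo : is_wellorder lt) (Hcard : lambda_succ_of_limit_cardinal lt m) :
  (forall S : L -> Prop, stationary lt S -> clubstar lt m S ->
     forall D : (L -> Prop) -> Prop, normal_filter lt D -> D S ->
       ~ saturated_succ D) /\
  (forall (S : L -> Prop) (D : (L -> Prop) -> Prop),
     stationary lt S -> normal_filter lt D -> D S -> clubstar_mod lt m S D ->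
       ~ saturated_succ D).
Proof.
split=> [S _ [P [Psmall Pguess]] D HD DS Hsat|S D _ HD DS Hclub Hsat].
  (* Clubs belong to every normal filter, so the first claim reduces to the second. *)
  apply: (clubstar_mod_not_saturated Hwo Hcard HD Hsat S DS).
  exists P; split=> // A /Pguess[C [clubC HC]]; exists C; split=> //.
  exact: (club_D Hwo Hcard HD).
exact: (clubstar_mod_not_saturated Hwo Hcard HD Hsat S DS).
Qed.
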